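(* Let $A$ be a Banach algebra and let $A^{\#}$ be its unitization. Then $A$ is ideally amenable if and only if $A^{\#}$ is ideally amenable.
   Context: $A^{\#}=A\oplus\mathbb{C}$ is the unital Banach algebra obtained by adjoining a unit to $A$, with product $(a+\alpha)(b+\beta)=ab+\alpha b+\beta a+\alpha\beta$ and norm $\|a+\alpha\|=\|a\|+|\alpha|$. For a Banach algebra $B$ and a Banach $B$-bimodule $X$ (jointly continuous module operations), the dual $X^*$ is a Banach $B$-bimodule via $\langle x,b\cdot x^*\rangle=\langle x\cdot b,x^*\rangle$ and $\langle x,x^*\cdot b\rangle=\langle b\cdot x,x^*\rangle$. A derivation $D:B\to X$ is a continuous linear map with $D(ab)=a\cdot D(b)+D(a)\cdot b$ for all $a,b\in B$; it is inner if there is $x\in X$ with $D(b)=b\cdot x-x\cdot b$ for all $b\in B$. $H^1(B,X)=\{0\}$ means every derivation $B\to X$ is inner. $B$ is ideally amenable if $H^1(B,I^* )=\{0\}$ for every closed two-sided ideal $I$ of $B$ (a Banach $B$-bimodule under multiplication). *)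

(* Defs.v *)
From HB Require Import structures.
From mathcomp Require Import all_boot all_order all_algebra.
From mathcomp Require Import complex.
From mathcomp Require Import all_classical all_reals topology normedtype.

Set Implicit Arguments.
Unset Strict Implicit.
Unset Printing Implicit Defensive.

Import Order.TTheory GRing.Theory Num.Theory.
Import numFieldNormedType.Exports.

Local Open Scope classical_set_scope.
Local Open Scope ring_scope.

(* Possibly non-unital, hence not built on the (unital) MathComp rings. *)
HB.mixin Record isBanachAlgebra (K : numFieldType) A
    & CompleteNormedModule K A := {
  bmul : A -> A -> A;
  bmulA : associative bmul;
  bmulDl : left_distributive bmul +%R;
  bmulDr : right_distributive bmul +%R;
  bmulZl : forall (k : K) (a b : A), bmul (k *: a) b = k *: bmul a b;
  bmulZr : forall (k : K) (a b : A), bmul a (k *: b) = k *: bmul a b;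
  norm_bmul : forall a b : A, `|bmul a b| <= `|a| * `|b|
}.

#[short(type="banachAlgType")]
HB.structure Definition BanachAlgebra (K : numFieldType) :=
  {A of CompleteNormedModule K A & isBanachAlgebra K A}.

HB.mixin Record isBanachBimodule (K : numFieldType) (B : banachAlgType K) X
    & CompleteNormedModule K X := {
  lact : B -> X -> X;
  ract : X -> B -> X;
  lactDl : forall (a b : B) (x : X), lact (a + b) x = lact a x + lact b x;
  lactDr : forall (a : B) (x y : X), lact a (x + y) = lact a x + lact a y;
  lactZl : forall (k : K) (a : B) (x : X), lact (k *: a) x = k *: lact a x;
  lactZr : forall (k : K) (a : B) (x : X), lact a (k *: x) = k *: lact a x;
  ractDl : forall (x y : X) (a : B), ract (x + y) a = ract x a + ract y a;
  ractDr : forall (x : X) (a b : B), ract x (a + b) = ract x a + ract x b;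
  ractZl : forall (k : K) (x : X) (a : B), ract (k *: x) a = k *: ract x a;
  ractZr : forall (k : K) (x : X) (a : B), ract x (k *: a) = k *: ract x a;
  lactM : forall (a b : B) (x : X), lact (bmul a b) x = lact a (lact b x);
  ractM : forall (x : X) (a b : B), ract x (bmul a b) = ract (ract x a) b;
  lractA : forall (a : B) (x : X) (b : B),
    ract (lact a x) b = lact a (ract x b);
  lact_continuous : continuous (fun p : B * X => lact p.1 p.2);
  ract_continuous : continuous (fun p : X * B => ract p.1 p.2)
}.

#[short(type="banachBimodType")]
HB.structure Definition BanachBimodule (K : numFieldType)
    (B : banachAlgType K) :=
  {X of CompleteNormedModule K X & isBanachBimodule K B X}.

Section cohomology.
Context (K : numFieldType) (B : banachAlgType K) (X : banachBimodType B).

Definition derivation (D : {linear B -> X}) : Prop :=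
  continuous D /\
  forall a b : B, D (bmul a b) = lact a (D b) + ract (D a) b.

Definition inner (D : B -> X) : Prop :=
  exists x : X, forall b : B, D b = lact b x - ract x b.

Definition H1_trivial : Prop :=
  forall D : {linear B -> X}, derivation D -> inner D.

End cohomology.
Arguments H1_trivial {K} B X.

Section bilinear_maps.
Context (K : numFieldType) (U V W : normedModType K) (h : U -> V -> W).
Hypotheses (hDl : forall u u' v, h (u + u') v = h u v + h u' v)
  (hDr : forall u v v', h u (v + v') = h u v + h u v')
  (hZl : forall k u v, h (k *: u) v = k *: h u v)
  (hZr : forall k u v, h u (k *: v) = k *: h u v).

Lemma bilinear_bound : continuous (fun p : U * V => h p.1 p.2) ->
  exists2 M : K, 0 <= M & forall u v, `|h u v| <= M * `|u| * `|v|.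
Proof.
move=> /(_ (0, 0)).
have h0 v : h 0 v = 0 by rewrite -(scale0r (0 : U)) hZl scale0r.
have h0r u : h u 0 = 0 by rewrite -(scale0r (0 : V)) hZr scale0r.
move=> /cvgrPdist_lt/(_ 1 ltr01).
rewrite /= h0 => -[[P Q] /= [/nbhs_norm0P [d d0 dP] /nbhs_norm0P [e e0 eQ]]] PQ.
have small (T : normedModType K) (t : T) (r : K) : 0 < r -> t != 0 ->
    `|(r / 2 / `|t|) *: t| < r.
  move=> r0 t0; have nt : 0 < `|t| by rewrite normr_gt0.
  rewrite normrZ gtr0_norm ?divr_gt0 // divfK ?gt_eqF //.
  by rewrite ltr_pdivrMr // ltr_pMr // ltr1n.
exists ((d / 2) * (e / 2))^-1; first by rewrite invr_ge0 ltW // mulr_gt0 // divr_gt0.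
move=> u v.
have [->|u0] := eqVneq u 0; first by rewrite h0 !normr0 mulr0 mul0r.
have [->|v0] := eqVneq v 0; first by rewrite h0r !normr0 mulr0.
have nu : 0 < `|u| by rewrite normr_gt0.
have nv : 0 < `|v| by rewrite normr_gt0.
have := PQ (d / 2 / `|u| *: u, e / 2 / `|v| *: v).
rewrite /= sub0r normrN => /(_ (conj (dP _ (small _ _ _ d0 u0))
  (eQ _ (small _ _ _ e0 v0)))) /ltW.
rewrite hZl hZr scalerA normrZ gtr0_norm; last by rewrite mulr_gt0 // !divr_gt0.
rewrite mulf_div -ler_pdivlMl; last by rewrite divr_gt0 // mulr_gt0 // divr_gt0.
rewrite mulr1 invf_div.
by move=> /le_trans; apply; rewrite [X in X <= _]mulrC [X in X <= _]mulrA.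
Qed.

Lemma bounded_bilinear_continuous (M : K) : 0 <= M ->
  (forall u v, `|h u v| <= M * `|u| * `|v|) ->
  continuous (fun p : U * V => h p.1 p.2).
Proof.
move=> M0 hM [a b]; apply/cvgrPdist_lt => e e0 /=.
have hE u v : `|h a b - h u v| <= M * `|a - u| * `|v| + M * `|a| * `|b - v|.
  have -> : h a b - h u v = h (a - u) v + h a (b - v).
    have -> : h (a - u) v = h a v - h u v by rewrite hDl -scaleN1r hZl scaleN1r.
    have -> : h a (b - v) = h a b - h a v by rewrite hDr -scaleN1r hZr scaleN1r.
    by rewrite [RHS]addrC addrA subrK.
  exact: le_trans (ler_normD _ _) (lerD (hM _ _) (hM _ _)).
have e20 : 0 < e / 2 by rewrite divr_gt0.
have b10 : 0 < `|b| + 1 by rewrite ltr_wpDl.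
have M10 : 0 < M + 1 by rewrite ltr_wpDl.
have a10 : 0 < `|a| + 1 by rewrite ltr_wpDl.
pose d := e / 2 / ((M + 1) * (`|b| + 1)).
pose d' := e / 2 / ((M + 1) * (`|a| + 1)).
have d0 : 0 < d by rewrite divr_gt0 // mulr_gt0.
have d'0 : 0 < d' by rewrite divr_gt0 // mulr_gt0.
exists ([set u | `|a - u| < d], [set v | `|b - v| < d' /\ `|b - v| < 1]).
  split => /=; first exact: (@cvgr_dist_lt K U _ _ _ id a _ d d0).
  near=> v; split; near: v.
    exact: (@cvgr_dist_lt K V _ _ _ id b _ d' d'0).
  exact: (@cvgr_dist_lt K V _ _ _ id b _ 1 ltr01).
move=> [u v] /= [ud [vd v1]].
apply: (le_lt_trans (hE u v)).
have vb : `|v| <= `|b| + 1.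
  have -> : v = b - (b - v) by rewrite subKr.
  by rewrite (le_trans (ler_normB _ _)) // lerD2l ltW.
have M1 : M <= M + 1 by rewrite lerDl.
have a1 : `|a| <= `|a| + 1 by rewrite lerDl.
have e1 : M * `|a - u| * `|v| < e / 2.
  apply: (@le_lt_trans _ _ (`|a - u| * ((M + 1) * (`|b| + 1)))).
    by rewrite mulrAC mulrC ler_wpM2l // ler_pM.
  by rewrite -ltr_pdivlMr // mulr_gt0.
have e2 : M * `|a| * `|b - v| < e / 2.
  apply: (@le_lt_trans _ _ (`|b - v| * ((M + 1) * (`|a| + 1)))).
    by rewrite mulrC ler_wpM2l // ler_pM.
  by rewrite -ltr_pdivlMr // mulr_gt0.
by rewrite [ltRHS]splitr ltrD.
Unshelve. all: by end_near. Qed.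

End bilinear_maps.

Definition norm_cauchy_cvg (K : numFieldType) (V : normedModType K) : Prop :=
  forall F : set_system V, ProperFilter F ->
    (forall e : K, 0 < e -> exists x, F [set y | `|x - y| < e]) ->
    exists l, forall e : K, 0 < e -> F [set y | `|l - y| < e].

Lemma norm_cauchy_cvgP (K : numFieldType) (V : normedModType K) :
  norm_cauchy_cvg V <->
  forall F : set_system V, ProperFilter F -> cauchy F -> cvg F.
Proof.
split=> H F FF.
  move=> /cauchyP cF.
  have [|l Fl] := H F FF.
    by move=> e e0; have [x Fx] := cF e e0; exists x; rewrite -ball_normE in Fx.
  by apply/cvg_ex; exists l; apply/cvgrPdist_lt.
move=> cF; have /H /cvg_ex [l /cvgrPdist_lt Fl] : cauchy F.
  apply/cauchyP => e e0.
  by have [x Fx] := cF e e0; exists x; rewrite -ball_normE.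
by exists l.
Qed.

Section complex_complete.
Variable R : realType.

Lemma Re_normK (V : normedModType R[i]) (x : V) :
  (complex.Re `|x|)%:C%C = `|x|.
Proof. by apply: RRe_real; exact: normr_real. Qed.

Lemma Re_posK (e : R[i]) : 0 < e -> (complex.Re e)%:C%C = e.
Proof. by move=> e0; apply: RRe_real; exact: gtr0_real. Qed.

Lemma Re_gt0 (e : R[i]) : 0 < e -> 0 < complex.Re e.
Proof. by move=> e0; rewrite -ltcR Re_posK. Qed.

Lemma normRe_le (z : R[i]) : (`|complex.Re z|)%:C%C <= `|z|.
Proof.
by rewrite normc_def lecR -sqrtr_sqr ler_wsqrtr // lerDl sqr_ge0.
Qed.

Lemma normIm_le (z : R[i]) : (`|complex.Im z|)%:C%C <= `|z|.
Proof.
by rewrite normc_def lecR -sqrtr_sqr ler_wsqrtr // lerDr sqr_ge0.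
Qed.

Lemma norm_leReIm (z : R[i]) :
  `|z| <= (`|complex.Re z| + `|complex.Im z|)%:C%C.
Proof.
rewrite normc_def lecR -[leRHS]ger0_norm ?addr_ge0 // -sqrtr_sqr.
rewrite ler_wsqrtr // sqrrD !real_normK ?num_real //.
by rewrite addrAC lerDl mulrn_wge0 // mulr_ge0.
Qed.

Lemma complex_cauchy_cvg : norm_cauchy_cvg (R[i]^o : normedModType R[i]).
Proof.
move=> F FF cF.
have part (p : R[i] -> R) : (forall x y, p (x - y) = p x - p y) ->
    (forall z, (`|p z|)%:C%C <= `|z|) ->
    exists l : R, forall e : R, 0 < e -> F [set y | `|l - p y| < e].
  move=> pB ple.
  have [|l pl] := (norm_cauchy_cvgP R).2 (@R_complete R) (p @ F) _.
    move=> e e0; have [|x Fx] := cF e%:C%C; first by rewrite ltcR.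
    exists (p x).
    change (F [set y | `|p x - p y| < e]); apply: filterS Fx => y /= xy.
    by rewrite -ltcR; apply: le_lt_trans xy; move: (ple (x - y)); rewrite pB.
  by exists l.
have [a Fa] := part (@complex.Re R)
  (fun x y => ltac:(by case: x; case: y)) normRe_le.
have [b Fb] := part (@complex.Im R)
  (fun x y => ltac:(by case: x; case: y)) normIm_le.
exists (Complex a b) => e e0.
have e20 : 0 < complex.Re e / 2 by rewrite divr_gt0 // Re_gt0.
apply: filterS2 (Fa _ e20) (Fb _ e20) => -[c d] /= ac bd.
rewrite -(Re_posK e0) (le_lt_trans (norm_leReIm _)) // ltcR /=.
by rewrite [ltRHS]splitr ltrD.
Qed.

End complex_complete.

(* [Unitization a k] is the element a + k of A (+) C; a dedicated record, since
   the product type A * C already carries the max norm. *)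
Record unitization (R : realType) (A : banachAlgType R[i]) := Unitization {
  alg_part : A;
  scal_part : R[i]
}.

Section unitization.
Context (R : realType) (A : banachAlgType R[i]).
Local Notation C := R[i].
Local Notation A1 := (unitization A).

Definition unitization_pair (x : A1) : A * C := (alg_part x, scal_part x).
Definition pair_unitization (p : A * C) : A1 := Unitization p.1 p.2.

Lemma unitization_pairK : cancel unitization_pair pair_unitization.
Proof. by case. Qed.

HB.instance Definition _ := Choice.copy A1 (can_type unitization_pairK).

Definition unitization_add (x y : A1) : A1 :=
  Unitization (alg_part x + alg_part y) (scal_part x + scal_part y).
Definition unitization_opp (x : A1) : A1 :=
  Unitization (- alg_part x) (- scal_part x).
Definition unitization_scale (k : C) (x : A1) : A1 :=
  Unitization (k *: alg_part x) (k * scal_part x).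

Fact unitization_addA : associative unitization_add.
Proof. by move=> x y z; congr Unitization; exact: addrA. Qed.
Fact unitization_addC : commutative unitization_add.
Proof. by move=> x y; congr Unitization; exact: addrC. Qed.
Fact unitization_add0 : left_id (Unitization 0 0) unitization_add.
Proof. by case=> a k; congr Unitization; exact: add0r. Qed.
Fact unitization_addN :
  left_inverse (Unitization 0 0) unitization_opp unitization_add.
Proof. by move=> x; congr Unitization; exact: addNr. Qed.

HB.instance Definition _ := GRing.isZmodule.Build A1
  unitization_addA unitization_addC unitization_add0 unitization_addN.

Fact unitization_scaleA (k l : C) (x : A1) :
  unitization_scale k (unitization_scale l x) = unitization_scale (k * l) x.
Proof. by congr Unitization; rewrite /= ?scalerA ?mulrA. Qed.
Fact unitization_scale1 : left_id 1 unitization_scale.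
Proof. by case=> a k; congr Unitization; rewrite /= ?scale1r ?mul1r. Qed.
Fact unitization_scaleDr : right_distributive unitization_scale +%R.
Proof. by move=> k x y; congr Unitization; rewrite /= ?scalerDr ?mulrDr. Qed.
Fact unitization_scaleDl (x : A1) :
  {morph unitization_scale^~ x : k l / k + l}.
Proof. by move=> k l; congr Unitization; rewrite /= ?scalerDl ?mulrDl. Qed.

HB.instance Definition _ := GRing.Zmodule_isLmodule.Build C A1
  unitization_scaleA unitization_scale1
  unitization_scaleDr unitization_scaleDl.

Definition unitization_norm (x : A1) : C := `|alg_part x| + `|scal_part x|.

Fact unitization_ler_normD (x y : A1) :
  unitization_norm (x + y) <= unitization_norm x + unitization_norm y.
Proof. by rewrite /unitization_norm addrACA lerD // ler_normD. Qed.
Fact unitization_normrZ (k : C) (x : A1) :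
  unitization_norm (k *: x) = `|k| * unitization_norm x.
Proof. by rewrite /unitization_norm /= normrZ normrM mulrDr. Qed.
Fact unitization_normr0_eq0 (x : A1) : unitization_norm x = 0 -> x = 0.
Proof.
case: x => a k /eqP; rewrite /unitization_norm /= paddr_eq0 //.
by rewrite !normr_eq0 => /andP[/eqP -> /eqP ->].
Qed.

HB.instance Definition _ := Lmodule_isNormed.Build C A1
  unitization_ler_normD unitization_normrZ unitization_normr0_eq0.

Lemma unitization_normE (x : A1) : `|x| = `|alg_part x| + `|scal_part x|.
Proof. by []. Qed.

Fact unitization_complete (F : set_system A1) :
  ProperFilter F -> cauchy F -> cvg F.
Proof.
have nc : norm_cauchy_cvg A1; last exact: (norm_cauchy_cvgP A1).1 nc F.
move=> {}F FF cF.
have [|a Fa] := (norm_cauchy_cvgP A).2 (@cauchy_cvg A) (@alg_part R A @ F) _.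
  move=> e e0; have [x Fx] := cF e e0; exists (alg_part x).
  change (F [set y | `|alg_part x - alg_part y| < e]).
  apply: filterS Fx => y /=; apply: le_lt_trans.
  by rewrite unitization_normE lerDl.
have [|k Fk] := @complex_cauchy_cvg R (@scal_part R A @ F) _.
  move=> e e0; have [x Fx] := cF e e0; exists (scal_part x).
  change (F [set y | `|scal_part x - scal_part y| < e]).
  apply: filterS Fx => y /=; apply: le_lt_trans.
  by rewrite unitization_normE lerDr.
exists (Unitization a k) => e e0.
have e20 : 0 < e / 2 by rewrite divr_gt0.
have Fa2 : F [set y | `|a - alg_part y| < e / 2] by exact: Fa.
have Fk2 : F [set y | `|k - scal_part y| < e / 2] by exact: Fk.
apply: filterS2 Fa2 Fk2 => y /= ay ky.
by rewrite unitization_normE [ltRHS]splitr ltrD.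
Qed.

HB.instance Definition _ :=
  Uniform_isComplete.Build A1 unitization_complete.

Definition unitization_mul (x y : A1) : A1 :=
  Unitization
    (bmul (alg_part x) (alg_part y)
     + scal_part x *: alg_part y + scal_part y *: alg_part x)
    (scal_part x * scal_part y).

Fact unitization_mulA : associative unitization_mul.
Proof.
case=> a k [b l] [c m]; congr Unitization; rewrite /= ?mulrA //.
rewrite !bmulDl !bmulDr !bmulZl !bmulZr !scalerDr !scalerA bmulA !addrA.
rewrite [m * k]mulrC [m * l]mulrC.
by rewrite [LHS](ACl (1 * 4 * 2 * 5 * 3 * 6 * 7)).
Qed.
Fact unitization_mulDl : left_distributive unitization_mul +%R.
Proof.
case=> a k [b l] [c m]; congr Unitization; rewrite /= ?mulrDl //.
by rewrite bmulDl scalerDl scalerDr !addrA [LHS](ACl (1 * 3 * 5 * 2 * 4 * 6)).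
Qed.
Fact unitization_mulDr : right_distributive unitization_mul +%R.
Proof.
case=> a k [b l] [c m]; congr Unitization; rewrite /= ?mulrDr //.
by rewrite bmulDr scalerDl scalerDr !addrA [LHS](ACl (1 * 3 * 5 * 2 * 4 * 6)).
Qed.
Fact unitization_mulZl (k : C) (x y : A1) :
  unitization_mul (k *: x) y = k *: unitization_mul x y.
Proof.
congr Unitization; rewrite /= ?mulrA //.
by rewrite bmulZl !scalerDr !scalerA [_ * k]mulrC.
Qed.
Fact unitization_mulZr (k : C) (x y : A1) :
  unitization_mul x (k *: y) = k *: unitization_mul x y.
Proof.
congr Unitization; rewrite /= 1?mulrCA //.
by rewrite bmulZr !scalerDr !scalerA [_ * k]mulrC.
Qed.
Fact unitization_norm_mul (x y : A1) :
  `|unitization_mul x y| <= `|x| * `|y|.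
Proof.
rewrite !unitization_normE /= mulrDl !mulrDr normrM.
rewrite addrA lerD2r (le_trans (ler_normD _ _)) //.
rewrite (le_trans (lerD (ler_normD _ _) (lexx _))) //.
rewrite !normrZ addrAC [`|scal_part y| * _]mulrC.
by rewrite !lerD2r norm_bmul.
Qed.

HB.instance Definition _ := isBanachAlgebra.Build C A1
  unitization_mulA unitization_mulDl unitization_mulDr
  unitization_mulZl unitization_mulZr unitization_norm_mul.

End unitization.

Record closed_ideal (K : numFieldType) (A : banachAlgType K) := ClosedIdeal {
  ideal_set :> set A;
  ideal_closed : closed ideal_set;
  ideal0 : ideal_set 0;
  idealD : forall x y : A, ideal_set x -> ideal_set y -> ideal_set (x + y);
  idealZ : forall (k : K) (x : A), ideal_set x -> ideal_set (k *: x);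
  ideal_mull : forall a x : A, ideal_set x -> ideal_set (bmul a x);
  ideal_mulr : forall a x : A, ideal_set x -> ideal_set (bmul x a)
}.

Section ideal_type.
Context (K : numFieldType) (A : banachAlgType K) (I : closed_ideal A).

Definition ideal_pred : {pred A} := [pred x | x \in ideal_set I].

Lemma ideal_predE (x : A) : (x \in ideal_pred) = (x \in ideal_set I).
Proof. by []. Qed.

Fact ideal_submod_closed : submod_closed ideal_pred.
Proof.
split=> [|k x y]; rewrite !ideal_predE !inE; first exact: ideal0.
by move=> Ix Iy; apply: idealD => //; exact: idealZ.
Qed.

HB.instance Definition _ :=
  GRing.isSubmodClosed.Build K A ideal_pred ideal_submod_closed.

Record ideal_type := IdealElt {
  ideal_val :> A;
  ideal_valP : ideal_val \in ideal_pred
}.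

HB.instance Definition _ := [isSub for ideal_val].
HB.instance Definition _ := [Choice of ideal_type by <:].
HB.instance Definition _ := [SubChoice_isSubLmodule of ideal_type by <:].

Definition ideal_norm (x : ideal_type) : K := `|ideal_val x|.

Fact ideal_ler_normD (x y : ideal_type) :
  ideal_norm (x + y) <= ideal_norm x + ideal_norm y.
Proof. exact: ler_normD. Qed.
Fact ideal_normrZ (k : K) (x : ideal_type) :
  ideal_norm (k *: x) = `|k| * ideal_norm x.
Proof. exact: normrZ. Qed.
Fact ideal_normr0_eq0 (x : ideal_type) : ideal_norm x = 0 -> x = 0.
Proof. by move=> /normr0_eq0 x0; exact: val_inj. Qed.

HB.instance Definition _ := Lmodule_isNormed.Build K ideal_type
  ideal_ler_normD ideal_normrZ ideal_normr0_eq0.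

Lemma ideal_normE (x : ideal_type) : `|x| = `|ideal_val x|.
Proof. by []. Qed.

Fact ideal_complete (F : set_system ideal_type) :
  ProperFilter F -> cauchy F -> cvg F.
Proof.
have nc : norm_cauchy_cvg ideal_type; last exact: (norm_cauchy_cvgP ideal_type).1 nc F.
move=> {}F FF cF.
have [|l Fl] := (norm_cauchy_cvgP A).2 (@cauchy_cvg A) (ideal_val @ F) _.
  move=> e e0; have [x Fx] := cF e e0; exists (ideal_val x).
  by change (F [set y | `|ideal_val x - ideal_val y| < e]); apply: filterS Fx.
have lI : l \in ideal_pred.
  rewrite ideal_predE inE; apply: (@ideal_closed _ _ I) => B.
  move=> /nbhs_normP [e /= e0 eB].
  have Fe : F [set y | `|l - ideal_val y| < e] by exact: Fl.
  have [y ly] := filter_ex Fe.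
  exists (ideal_val y); split; last exact: eB.
  by have := ideal_valP y; rewrite ideal_predE inE.
by exists (IdealElt lI) => e e0; exact: Fl.
Qed.

HB.instance Definition _ :=
  Uniform_isComplete.Build ideal_type ideal_complete.

Fact ideal_lact_subproof (a : A) (x : ideal_type) :
  bmul a (ideal_val x) \in ideal_pred.
Proof.
have := ideal_valP x; rewrite !ideal_predE !inE; exact: ideal_mull.
Qed.
Fact ideal_ract_subproof (x : ideal_type) (a : A) :
  bmul (ideal_val x) a \in ideal_pred.
Proof.
have := ideal_valP x; rewrite !ideal_predE !inE; exact: ideal_mulr.
Qed.

Definition ideal_lact (a : A) (x : ideal_type) : ideal_type :=
  IdealElt (ideal_lact_subproof a x).
Definition ideal_ract (x : ideal_type) (a : A) : ideal_type :=
  IdealElt (ideal_ract_subproof x a).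

Fact ideal_lactDl (a b : A) (x : ideal_type) :
  ideal_lact (a + b) x = ideal_lact a x + ideal_lact b x.
Proof. by apply: val_inj; exact: bmulDl. Qed.
Fact ideal_lactDr (a : A) (x y : ideal_type) :
  ideal_lact a (x + y) = ideal_lact a x + ideal_lact a y.
Proof. by apply: val_inj; exact: bmulDr. Qed.
Fact ideal_lactZl (k : K) (a : A) (x : ideal_type) :
  ideal_lact (k *: a) x = k *: ideal_lact a x.
Proof. by apply: val_inj; exact: bmulZl. Qed.
Fact ideal_lactZr (k : K) (a : A) (x : ideal_type) :
  ideal_lact a (k *: x) = k *: ideal_lact a x.
Proof. by apply: val_inj; exact: bmulZr. Qed.
Fact ideal_ractDl (x y : ideal_type) (a : A) :
  ideal_ract (x + y) a = ideal_ract x a + ideal_ract y a.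
Proof. by apply: val_inj; exact: bmulDl. Qed.
Fact ideal_ractDr (x : ideal_type) (a b : A) :
  ideal_ract x (a + b) = ideal_ract x a + ideal_ract x b.
Proof. by apply: val_inj; exact: bmulDr. Qed.
Fact ideal_ractZl (k : K) (x : ideal_type) (a : A) :
  ideal_ract (k *: x) a = k *: ideal_ract x a.
Proof. by apply: val_inj; exact: bmulZl. Qed.
Fact ideal_ractZr (k : K) (x : ideal_type) (a : A) :
  ideal_ract x (k *: a) = k *: ideal_ract x a.
Proof. by apply: val_inj; exact: bmulZr. Qed.
Fact ideal_lactM (a b : A) (x : ideal_type) :
  ideal_lact (bmul a b) x = ideal_lact a (ideal_lact b x).
Proof. by apply: val_inj; rewrite /= bmulA. Qed.
Fact ideal_ractM (x : ideal_type) (a b : A) :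
  ideal_ract x (bmul a b) = ideal_ract (ideal_ract x a) b.
Proof. by apply: val_inj; rewrite /= bmulA. Qed.
Fact ideal_lractA (a : A) (x : ideal_type) (b : A) :
  ideal_ract (ideal_lact a x) b = ideal_lact a (ideal_ract x b).
Proof. by apply: val_inj; rewrite /= bmulA. Qed.
Fact ideal_lact_continuous :
  continuous (fun p : A * ideal_type => ideal_lact p.1 p.2).
Proof.
apply: (bounded_bilinear_continuous ideal_lactDl ideal_lactDr
  ideal_lactZl ideal_lactZr (ler01 : 0 <= 1 :> K)) => a x.
by rewrite mul1r; exact: norm_bmul.
Qed.
Fact ideal_ract_continuous :
  continuous (fun p : ideal_type * A => ideal_ract p.1 p.2).
Proof.
apply: (bounded_bilinear_continuous ideal_ractDl ideal_ractDr
  ideal_ractZl ideal_ractZr (ler01 : 0 <= 1 :> K)) => x a.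
by rewrite mul1r; exact: norm_bmul.
Qed.

HB.instance Definition _ := isBanachBimodule.Build K A ideal_type
  ideal_lactDl ideal_lactDr ideal_lactZl ideal_lactZr
  ideal_ractDl ideal_ractDr ideal_ractZl ideal_ractZr
  ideal_lactM ideal_ractM ideal_lractA
  ideal_lact_continuous ideal_ract_continuous.

End ideal_type.

Section dual.
Context (R : realType) (X : normedModType R[i]).
Local Notation C := R[i].

Definition dual_pred : {pred X -> C^o} :=
  [pred f : X -> C^o | `[< linear f /\ continuous f >]].

Lemma dual_predP (f : X -> C^o) :
  reflect (linear f /\ continuous f) (f \in dual_pred).
Proof. exact: asboolP. Qed.

Fact dual_submod_closed : submod_closed dual_pred.
Proof.
split=> [|k f g /dual_predP [lf cf] /dual_predP [lg cg]]; apply/dual_predP; split.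
- by move=> k x y; rewrite scaler0 addr0.
- by move=> x; exact: cvg_cst.
- move=> c x y; rewrite /= !fctE lf lg !scalerDr addrACA; congr (_ + _ + _).
  by rewrite !scalerA mulrC.
- by move=> x; apply: cvgD; [apply: cvgZr; exact: cf | exact: cg].
Qed.

HB.instance Definition _ :=
  GRing.isSubmodClosed.Build C (X -> C^o) dual_pred dual_submod_closed.

Record dual := Dual {
  dual_fun :> X -> C^o;
  dual_funP : dual_fun \in dual_pred
}.

HB.instance Definition _ := [isSub for dual_fun].
HB.instance Definition _ := [Choice of dual by <:].
HB.instance Definition _ := [SubChoice_isSubLmodule of dual by <:].

Lemma dual_linear (f : dual) : linear f.
Proof. by have /dual_predP[] := dual_funP f. Qed.

HB.instance Definition _ (f : dual) :=
  GRing.isLinear.Build C X C^o *:%R (dual_fun f) (dual_linear f).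

Lemma dual_continuous (f : dual) : continuous f.
Proof. by have /dual_predP[] := dual_funP f. Qed.

Lemma dual_ext (f g : dual) : (forall x, f x = g x) -> f = g.
Proof. by move=> fg; apply: val_inj; apply/funext. Qed.

Lemma dual_bounded (f : dual) :
  exists2 M : C, 0 <= M & forall x, `|f x| <= M * `|x|.
Proof.
have /linear_boundedP : bounded_near f (nbhs (0 : X)).
  by apply/linear_bounded_continuous; exact: dual_continuous.
by move=> /pinfty_ex_gt0 [M M0 fM]; exists M => //; exact: ltW.
Qed.

Lemma dual_of_bounded (f : X -> C^o) (M : C) :
  linear f -> (forall x, `|f x| <= M * `|x|) -> f \in dual_pred.
Proof.
move=> lf fM; apply/dual_predP; split=> //.
pose g : {linear X -> C^o} := HB.pack f (GRing.isLinear.Build C X C^o *:%R f lf).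
have : continuous g; last by [].
apply: bounded_linear_continuous; apply/ex_bound; exists `|M|.
apply/nbhs_norm0P; exists 1 => //= x /= /ltW x1.
rewrite (le_trans (fM x)) //.
have [->|x0] := eqVneq x 0; first by rewrite normr0 mulr0.
have M0 : 0 <= M.
  by rewrite -(pmulr_lge0 _ (_ : 0 < `|x|)) ?normr_gt0 // (le_trans _ (fM x)).
by rewrite ger0_norm // ler_piMr.
Qed.

(* The values |f x| are real but of type R[i], hence the [Re]. *)
Definition opnorm (f : dual) : R :=
  sup [set complex.Re `|f x| | x in [set x : X | `|x| <= 1]].

Definition dual_norm (f : dual) : C := (opnorm f)%:C%C.

Lemma opnorm_has_sup (f : dual) :
  has_sup [set complex.Re `|f x| | x in [set x : X | `|x| <= 1]].
Proof.
split; first by exists (complex.Re `|f 0|); exists 0 => //=; rewrite normr0.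
have [M M0 fM] := dual_bounded f; exists (complex.Re M) => _ [x /= x1 <-].
rewrite -lecR (@Re_normK R C^o) RRe_real ?ger0_real //.
by rewrite (le_trans (fM x)) // ler_piMr.
Qed.

Lemma opnorm_ge0 (f : dual) : 0 <= opnorm f.
Proof.
have -> : 0 = complex.Re `|f 0| by rewrite linear0 normr0.
apply: sup_upper_bound; first exact: opnorm_has_sup.
by exists 0 => //=; rewrite normr0.
Qed.

Lemma dual_norm_bound (f : dual) (x : X) : `|f x| <= dual_norm f * `|x|.
Proof.
have [->|x0] := eqVneq x 0; first by rewrite linear0 !normr0 mulr0.
have nx : 0 < `|x| by rewrite normr_gt0.
rewrite -ler_pdivrMr //.
have -> : `|f x| / `|x| = `|f (`|x|^-1 *: x)|.
  by rewrite linearZ /= normrM normfV normr_id mulrC.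
rewrite -(@Re_normK R C^o) lecR.
apply: sup_upper_bound; first exact: opnorm_has_sup.
exists (`|x|^-1 *: x) => //=.
by rewrite normrZ normfV normr_id mulVf // gt_eqF.
Qed.

Lemma dual_norm_le (f : dual) (M : C) : 0 <= M ->
  (forall x, `|f x| <= M * `|x|) -> dual_norm f <= M.
Proof.
move=> M0 fM; rewrite -(RRe_real (ger0_real M0)) lecR.
apply: ge_sup; first by case: (opnorm_has_sup f).
move=> _ [x /= x1 <-].
rewrite -lecR (@Re_normK R C^o) RRe_real ?ger0_real //.
by rewrite (le_trans (fM x)) // ler_piMr.
Qed.

Lemma dual_norm_ge0 (f : dual) : 0 <= dual_norm f.
Proof. by rewrite lecR opnorm_ge0. Qed.

Fact dual_ler_normD (f g : dual) :
  dual_norm (f + g) <= dual_norm f + dual_norm g.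
Proof.
apply: dual_norm_le; first by rewrite addr_ge0 // dual_norm_ge0.
move=> x; rewrite mulrDl (le_trans (ler_normD _ _)) //.
by rewrite lerD // dual_norm_bound.
Qed.

Fact dual_normr0_eq0 (f : dual) : dual_norm f = 0 -> f = 0.
Proof.
move=> f0; apply: dual_ext => x; apply/eqP; rewrite -normr_le0.
by rewrite (le_trans (dual_norm_bound f x)) // f0 mul0r.
Qed.

Fact dual_normrZ (k : C) (f : dual) :
  dual_norm (k *: f) = `|k| * dual_norm f.
Proof.
have le (l : C) (g : dual) : dual_norm (l *: g) <= `|l| * dual_norm g.
  apply: dual_norm_le; first by rewrite mulr_ge0 // dual_norm_ge0.
  by move=> x; rewrite normrM -mulrA ler_wpM2l // dual_norm_bound.
apply/eqP; rewrite eq_le le /=.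
have [->|k0] := eqVneq k 0; first by rewrite normr0 mul0r dual_norm_ge0.
have := le k^-1 (k *: f).
by rewrite scalerA mulVf // scale1r normfV ler_pdivlMl // normr_gt0.
Qed.

HB.instance Definition _ := Lmodule_isNormed.Build C dual
  dual_ler_normD dual_normrZ dual_normr0_eq0.

Lemma dual_normE (f : dual) :
  `|f| = (sup [set complex.Re `|f x| | x in [set x : X | `|x| <= 1]])%:C%C.
Proof. by []. Qed.

Lemma dual_le (f : dual) (x : X) : `|f x| <= `|f| * `|x|.
Proof. exact: dual_norm_bound. Qed.

Lemma dual_norm_leP (f : dual) (M : C) : 0 <= M ->
  (forall x, `|f x| <= M * `|x|) -> `|f| <= M.
Proof. exact: dual_norm_le. Qed.

Fact dual_complete (F : set_system dual) :
  ProperFilter F -> cauchy F -> cvg F.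
Proof.
have nc : norm_cauchy_cvg dual; last exact: (norm_cauchy_cvgP dual).1 nc F.
move=> {}F FF cF.
have lim (x : X) : exists l : C^o, forall e : C, 0 < e ->
    F [set f : dual | `|l - f x| < e].
  have [|l Fl] := @complex_cauchy_cvg R ((fun f : dual => f x) @ F) _.
    move=> e e0; have x10 : 0 < `|x| + 1 by rewrite ltr_wpDl.
    have [f Ff] := cF (e / (`|x| + 1)) (divr_gt0 e0 x10).
    exists (f x); change (F [set g : dual | `|f x - g x| < e]).
    apply: filterS Ff => g /= fg; apply: (le_lt_trans (dual_le (f - g) x)).
    apply: (@le_lt_trans _ _ (`|f - g| * (`|x| + 1))).
      by rewrite ler_wpM2l // lerDl.
    by rewrite -ltr_pdivlMr.
  by exists l.
have {lim} /choice [g Fg] := lim.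
have gE x z : (forall e : C, 0 < e -> F [set f : dual | `|z - f x| < e]) ->
    g x = z.
  move=> Fz; apply/eqP; rewrite -subr_eq0 -normr_le0.
  apply/ler_addgt0Pl => e e0; rewrite addr0.
  have e20 : 0 < e / 2 by rewrite divr_gt0.
  have [f [/= h1 h2]] := filter_ex (filterI (Fg x _ e20) (Fz _ e20)).
  rewrite -(subrK (f x) (g x)) -addrA (le_trans (ler_normD _ _)) //.
  by rewrite [leRHS]splitr lerD // ltW // distrC.
have lg : linear g.
  move=> k x y; apply: gE => e e0.
  have k10 : 0 < `|k| + 1 by rewrite ltr_wpDl.
  have e20 : 0 < e / 2 by rewrite divr_gt0.
  apply: filterS2 (Fg x _ (divr_gt0 e20 k10)) (Fg y _ e20) => f /= fx fy.
  rewrite linearP opprD addrACA -scalerBr (le_lt_trans (ler_normD _ _)) //.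
  rewrite [ltRHS]splitr ltrD // normrZ.
  apply: (@le_lt_trans _ _ (`|g x - f x| * (`|k| + 1))).
    by rewrite mulrC ler_wpM2l // lerDl.
  by rewrite -ltr_pdivlMr.
have unif (e : C) : 0 < e ->
    F [set f : dual | forall x, `|g x - f x| <= e * `|x|].
  move=> e0; have e20 : 0 < e / 2 by rewrite divr_gt0.
  have [f0 Ff0] := cF _ e20.
  have b0 f x : `|f0 - f| < e / 2 -> `|f0 x - f x| <= e / 2 * `|x|.
    by move=> /ltW h; rewrite (le_trans (dual_le (f0 - f) x)) // ler_wpM2r.
  have gf0 x : `|g x - f0 x| <= e / 2 * `|x|.
    apply/ler_addgt0Pl => d d0.
    have [f [/= h1 h2]] := filter_ex (filterI (Fg x _ d0) Ff0).
    rewrite -(subrK (f x) (g x)) -addrA (le_trans (ler_normD _ _)) //.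
    by have := b0 f x h2; rewrite distrC; exact: lerD (ltW h1).
  apply: filterS Ff0 => f /= h x.
  rewrite -(subrK (f0 x) (g x)) -addrA (le_trans (ler_normD _ _)) //.
  by rewrite [e]splitr mulrDl; exact: lerD (gf0 x) (b0 f x h).
have [f0 /= Ff0] := filter_ex (unif 1 ltr01).
have gP : g \in dual_pred.
  apply: (@dual_of_bounded _ (1 + `|f0|)) => // x.
  rewrite -(subrK (f0 x) (g x)) (le_trans (ler_normD _ _)) //.
  by rewrite mulrDl lerD // dual_le.
exists (Dual gP) => e e0.
have e20 : 0 < e / 2 by rewrite divr_gt0.
apply: filterS (unif _ e20) => f /= fe.
apply: (@le_lt_trans _ _ (e / 2)); last by rewrite ltr_pdivrMr // ltr_pMr // ltr1n.
by apply: dual_norm_leP => //; exact: ltW.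
Qed.

HB.instance Definition _ := Uniform_isComplete.Build dual dual_complete.

End dual.
Arguments dual_pred {R} X.

Section dual_bimodule.
Context (R : realType) (B : banachAlgType R[i]) (X : banachBimodType B).
Local Notation C := R[i].
Local Notation X' := (dual X).

Lemma lact_bound : exists2 M : C, 0 <= M &
  forall (a : B) (x : X), `|lact a x| <= M * `|a| * `|x|.
Proof.
exact: (bilinear_bound (@lactZl _ B X) (@lactZr _ B X) (@lact_continuous _ B X)).
Qed.

Lemma ract_bound : exists2 M : C, 0 <= M &
  forall (x : X) (a : B), `|ract x a| <= M * `|x| * `|a|.
Proof.
exact: (bilinear_bound (@ractZl _ B X) (@ractZr _ B X) (@ract_continuous _ B X)).
Qed.

Lemma dual_lact_bound (M : C) : 0 <= M ->
  (forall (x : X) (a : B), `|ract x a| <= M * `|x| * `|a|) ->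
  forall (a : B) (f : X') (x : X), `|f (ract x a)| <= M * `|a| * `|f| * `|x|.
Proof.
move=> M0 hM a f x; rewrite (le_trans (dual_le f _)) //.
by rewrite -[leRHS]mulrA mulrCA ler_wpM2l // mulrAC hM.
Qed.

Lemma dual_ract_bound (M : C) : 0 <= M ->
  (forall (a : B) (x : X), `|lact a x| <= M * `|a| * `|x|) ->
  forall (f : X') (a : B) (x : X), `|f (lact a x)| <= M * `|f| * `|a| * `|x|.
Proof.
move=> M0 hM f a x; rewrite (le_trans (dual_le f _)) //.
by rewrite -!mulrA mulrCA ler_wpM2l // mulrA hM.
Qed.

Fact dual_lact_subproof (a : B) (f : X') :
  (fun x : X => f (ract x a)) \in dual_pred X.
Proof.
have [M M0 hM] := ract_bound.
apply: dual_of_bounded (dual_lact_bound M0 hM a f).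
by move=> k x y; rewrite ractDl ractZl linearP.
Qed.

Fact dual_ract_subproof (f : X') (a : B) :
  (fun x : X => f (lact a x)) \in dual_pred X.
Proof.
have [M M0 hM] := lact_bound.
apply: dual_of_bounded (dual_ract_bound M0 hM f a).
by move=> k x y; rewrite lactDr lactZr linearP.
Qed.

Definition dual_lact (a : B) (f : X') : X' := Dual (dual_lact_subproof a f).
Definition dual_ract (f : X') (a : B) : X' := Dual (dual_ract_subproof f a).

Fact dual_lactDl (a b : B) (f : X') :
  dual_lact (a + b) f = dual_lact a f + dual_lact b f.
Proof. by apply: dual_ext => x; rewrite /= ractDr linearD. Qed.
Fact dual_lactDr (a : B) (f g : X') :
  dual_lact a (f + g) = dual_lact a f + dual_lact a g.
Proof. exact: dual_ext. Qed.
Fact dual_lactZl (k : C) (a : B) (f : X') :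
  dual_lact (k *: a) f = k *: dual_lact a f.
Proof. by apply: dual_ext => x; rewrite /= ractZr linearZ. Qed.
Fact dual_lactZr (k : C) (a : B) (f : X') :
  dual_lact a (k *: f) = k *: dual_lact a f.
Proof. exact: dual_ext. Qed.
Fact dual_ractDl (f g : X') (a : B) :
  dual_ract (f + g) a = dual_ract f a + dual_ract g a.
Proof. exact: dual_ext. Qed.
Fact dual_ractDr (f : X') (a b : B) :
  dual_ract f (a + b) = dual_ract f a + dual_ract f b.
Proof. by apply: dual_ext => x; rewrite /= lactDl linearD. Qed.
Fact dual_ractZl (k : C) (f : X') (a : B) :
  dual_ract (k *: f) a = k *: dual_ract f a.
Proof. exact: dual_ext. Qed.
Fact dual_ractZr (k : C) (f : X') (a : B) :
  dual_ract f (k *: a) = k *: dual_ract f a.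
Proof. by apply: dual_ext => x; rewrite /= lactZl linearZ. Qed.
Fact dual_lactM (a b : B) (f : X') :
  dual_lact (bmul a b) f = dual_lact a (dual_lact b f).
Proof. by apply: dual_ext => x; rewrite /= ractM. Qed.
Fact dual_ractM (f : X') (a b : B) :
  dual_ract f (bmul a b) = dual_ract (dual_ract f a) b.
Proof. by apply: dual_ext => x; rewrite /= lactM. Qed.
Fact dual_lractA (a : B) (f : X') (b : B) :
  dual_ract (dual_lact a f) b = dual_lact a (dual_ract f b).
Proof. by apply: dual_ext => x; rewrite /= lractA. Qed.
Fact dual_lact_continuous :
  continuous (fun p : B * X' => dual_lact p.1 p.2).
Proof.
have [M M0 hM] := ract_bound.
apply: (bounded_bilinear_continuous dual_lactDl dual_lactDr
  dual_lactZl dual_lactZr M0) => a f.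
by apply: dual_norm_leP; [rewrite !mulr_ge0 | exact: dual_lact_bound].
Qed.
Fact dual_ract_continuous :
  continuous (fun p : X' * B => dual_ract p.1 p.2).
Proof.
have [M M0 hM] := lact_bound.
apply: (bounded_bilinear_continuous dual_ractDl dual_ractDr
  dual_ractZl dual_ractZr M0) => f a.
by apply: dual_norm_leP; [rewrite !mulr_ge0 | exact: dual_ract_bound].
Qed.

HB.instance Definition _ := isBanachBimodule.Build C B (dual X)
  dual_lactDl dual_lactDr dual_lactZl dual_lactZr
  dual_ractDl dual_ractDr dual_ractZl dual_ractZr
  dual_lactM dual_ractM dual_lractA
  dual_lact_continuous dual_ract_continuous.

End dual_bimodule.

Definition ideally_amenable (R : realType) (A : banachAlgType R[i]) : Prop :=
  forall I : closed_ideal A, H1_trivial A (dual (ideal_type I)).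

(* Main.v *)
(* If [A^#] is ideally amenable, a derivation [D : A -> I^*] extends to [A^#] by
   [D 1 = 0], the ideal [I] being also an ideal of [A^#].
   Conversely let [J] be a closed ideal of [A^#], [I] its trace on [A], and
   [D : A^# -> J^*] a derivation.  For a suitable [e] in [A] (0 if [J] lies in [A],
   a lift of the unit of [A/I] otherwise), [x + k |-> x + k e] is a bounded
   retraction of [J] onto [I].  Restricted to [A -> I^*], [D] is inner,
   implemented by some [phi]; extend [phi] to [J] along the retraction and subtract
   from [D] the resulting inner derivation, so that now [D a] vanishes on [I] for
   [a] in [A].  For fixed [j] in [J] the functional [a |-> <D a, j>] then kills all
   products, as [ja] and [aj] are in [I], hence is 0 because [H^1(A, A^* ) = 0].
   Thus [D] vanishes on [A], and at 1. *)
Require Import Defs.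
From HB Require Import structures.
From mathcomp Require Import all_boot all_order all_algebra.
From mathcomp Require Import complex.
From mathcomp Require Import all_classical all_reals topology normedtype.

Set Implicit Arguments.
Unset Strict Implicit.
Unset Printing Implicit Defensive.

Import Order.TTheory GRing.Theory Num.Theory.
Import numFieldNormedType.Exports.

Local Open Scope classical_set_scope.
Local Open Scope ring_scope.

(** * Bounded linear maps and inner derivations *)

Lemma continuous_of_bound (K : numFieldType) (V W : normedModType K)
    (T : {linear V -> W}) (M : K) : 0 <= M ->
  (forall x, `|T x| <= M * `|x|) -> continuous T.
Proof.
move=> M0 TM; apply: bounded_linear_continuous; apply/ex_bound; exists M.
apply/nbhs_norm0P; exists 1 => //= x /= /ltW x1.
by rewrite (le_trans (TM x)) // ler_piMr.
Qed.

Section derivations.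
Context (R : realType) (B : banachAlgType R[i]) (X : banachBimodType B).

Definition ad (x : X) (b : B) : X := lact b x - ract x b.

Fact ad_linear (x : X) : linear (ad x).
Proof.
move=> k a b; rewrite /ad lactDl lactZl ractDr ractZr opprD scalerBr.
by rewrite addrACA.
Qed.

HB.instance Definition _ (x : X) :=
  GRing.isLinear.Build R[i] B X *:%R (ad x) (ad_linear x).

Lemma lactN (a : B) (x : X) : lact a (- x) = - lact a x.
Proof. by rewrite -scaleN1r lactZr scaleN1r. Qed.

Lemma ractN (x : X) (a : B) : ract (- x) a = - ract x a.
Proof. by rewrite -scaleN1r ractZl scaleN1r. Qed.

(** The middle terms [a x b] cancel because the two actions commute; continuity follows from the
    bounds of both actions. *)
Lemma derivation_ad (x : X) : derivation (ad x).
Proof.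
split=> [|a b]; last first.
  rewrite /= /ad lactDr lactN ractDl ractN lactM ractM lractA.
  by rewrite addrA subrK.
have [M M0 hM] := lact_bound X; have [N N0 hN] := ract_bound X.
apply: (@continuous_of_bound _ _ _ _ (M * `|x| + N * `|x|)).
  by rewrite addr_ge0 ?mulr_ge0.
move=> b; rewrite (le_trans (ler_normB _ _)) // mulrDl lerD //.
by rewrite mulrAC hM.
Qed.

Lemma derivationB (D E : {linear B -> X}) :
  derivation D -> derivation E -> derivation (D \- E).
Proof.
move=> [cD DM] [cE EM]; split=> [b|a b] /=.
  by apply: cvgB; [exact: cD | exact: cE].
by rewrite DM EM lactDr lactN ractDl ractN opprD addrACA.
Qed.

(** The Leibniz rule at [u = u u] reads [D u = D u + D u]. *)
Lemma derivation_unit (D : {linear B -> X}) (u : B) : derivation D ->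
  bmul u u = u -> (forall x : X, lact u x = x) -> (forall x : X, ract x u = x) ->
  D u = 0.
Proof.
move=> [_ DM] uu ul ur; have := DM u u.
by rewrite uu ul ur => /eqP; rewrite -subr_eq0 opprD addNKr oppr_eq0 => /eqP.
Qed.

End derivations.

(** * Adjoints of bounded maps and pulled-back derivations *)

Section pullback.
Context (R : realType) (V W : normedModType R[i]) (T : {linear V -> W}).
Hypothesis cT : continuous T.

Fact dual_pullback_subproof (f : dual W) : (f \o T : V -> R[i]^o) \in dual_pred V.
Proof.
apply/dual_predP; split=> [k x y|x] /=; first by rewrite !linearP.
by apply: continuous_comp; [exact: cT | exact: dual_continuous].
Qed.

Definition dual_pullback (f : dual W) : dual V := Dual (dual_pullback_subproof f).

Fact dual_pullback_linear : linear dual_pullback.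
Proof. by move=> k f g; exact: dual_ext. Qed.

HB.instance Definition _ :=
  GRing.isLinear.Build R[i] (dual W) (dual V) *:%R dual_pullback
    dual_pullback_linear.

Lemma dual_pullback_continuous : continuous dual_pullback.
Proof.
have /linear_boundedP : bounded_near T (nbhs (0 : V)).
  by apply/linear_bounded_continuous.
move=> /pinfty_ex_gt0 [M M0 TM].
apply: (@continuous_of_bound _ _ _ _ M); first exact: ltW.
move=> f; apply: dual_norm_leP => [|x]; first by rewrite mulr_ge0 // ltW.
by rewrite (le_trans (dual_le f _)) // -mulrA mulrCA ler_wpM2l.
Qed.

End pullback.

Lemma dual_eval_continuous (R : realType) (X : normedModType R[i]) (x : X) :
  continuous (fun f : dual X => f x).
Proof.
have lin : linear (fun f : dual X => f x : R[i]^o) by [].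
pose ev : {linear dual X -> R[i]^o} :=
  HB.pack (fun f : dual X => f x : R[i]^o) (GRing.isLinear.Build _ _ _ _ _ lin).
have : continuous ev; last by [].
apply: (@continuous_of_bound _ _ _ _ `|x|) => // f.
by rewrite mulrC; exact: dual_le.
Qed.

(** The dual actions evaluate functionals at [x a] and [b x], so the adjoint of a map [T] compatible
    with the actions through [h] preserves the Leibniz rule. This serves to restrict a derivation on
    [unitization A] to [A]. *)
Lemma derivation_pullback (R : realType) (B B' : banachAlgType R[i])
    (X : banachBimodType B) (Y : banachBimodType B')
    (h : {linear B -> B'}) (T : {linear X -> Y})
    (ch : continuous h) (cT : continuous T) :
  {morph h : a b / bmul a b} ->
  (forall a x, T (lact a x) = lact (h a) (T x)) ->
  (forall x a, T (ract x a) = ract (T x) (h a)) ->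
  forall D : {linear B' -> dual Y}, derivation D ->
  derivation (dual_pullback cT \o D \o h).
Proof.
move=> hM Tl Tr D [cD DM]; split=> [b|a b].
  apply: continuous_comp; first exact: ch.
  by apply: continuous_comp; [exact: cD | exact: dual_pullback_continuous].
rewrite /= hM DM; apply: dual_ext => x.
change (D (h b) (ract (T x) (h a)) + D (h a) (lact (h b) (T x)) =
  D (h b) (T (ract x a)) + D (h a) (T (lact b x))).
by rewrite Tl Tr.
Qed.

(** * The embedding of A and the two coordinates of its unitization *)

Section unitization_maps.
Context (R : realType) (A : banachAlgType R[i]).
Local Notation C := R[i].
Local Notation A1 := (unitization A).

Definition embed (a : A) : A1 := Unitization a 0.

Fact embed_linear : linear embed.
Proof. by move=> k a b; congr Unitization; rewrite /= mulr0 addr0. Qed.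

HB.instance Definition _ := GRing.isLinear.Build C A A1 *:%R embed embed_linear.

Fact alg_part_linear : linear (@alg_part R A).
Proof. by []. Qed.

HB.instance Definition _ :=
  GRing.isLinear.Build C A1 A *:%R (@alg_part R A) alg_part_linear.

Lemma embed_norm (a : A) : `|embed a| = `|a|.
Proof. by rewrite unitization_normE normr0 addr0. Qed.

Lemma embed_continuous : continuous embed.
Proof.
by apply: (continuous_of_bound ler01) => a; rewrite embed_norm mul1r.
Qed.

Lemma alg_part_norm (x : A1) : `|alg_part x| <= `|x|.
Proof. by rewrite unitization_normE lerDl. Qed.

Lemma scal_part_norm (x : A1) : `|scal_part x| <= `|x|.
Proof. by rewrite unitization_normE lerDr. Qed.

Lemma alg_part_continuous : continuous (@alg_part R A).
Proof.
by apply: (continuous_of_bound ler01) => x; rewrite mul1r alg_part_norm.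
Qed.

Fact scal_part_linear : linear (@scal_part R A : A1 -> C^o).
Proof. by []. Qed.

HB.instance Definition _ :=
  GRing.isLinear.Build C A1 C^o *:%R (@scal_part R A) scal_part_linear.

Lemma scal_part_continuous : continuous (@scal_part R A : A1 -> C^o).
Proof.
by apply: (continuous_of_bound ler01) => x; rewrite mul1r scal_part_norm.
Qed.

Lemma embedM (a b : A) : embed (bmul a b) = bmul (embed a) (embed b).
Proof.
congr Unitization; last by rewrite /= mulr0.
by rewrite /= !scale0r !addr0.
Qed.

Lemma unitization_split (x : A1) :
  x = embed (alg_part x) + scal_part x *: Unitization 0 1.
Proof.
by case: x => a k; congr Unitization; rewrite /= ?scaler0 ?addr0 ?add0r ?mulr1.
Qed.

Lemma unitization_mul1 : left_id (Unitization 0 1 : A1) bmul.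
Proof.
move=> [a k]; congr Unitization; rewrite /= ?mul1r //.
(* Writing 0 as [0 *: 0] lets homogeneity of [bmul] kill the product with 0. *)
by rewrite -(scale0r (0 : A)) bmulZl !scale0r scale1r scaler0 addr0 add0r.
Qed.

Lemma unitization_mulr1 : right_id (Unitization 0 1 : A1) bmul.
Proof.
move=> [a k]; congr Unitization; rewrite /= ?mulr1 //.
by rewrite -(scale0r (0 : A)) bmulZr !scale0r scale1r scaler0 !add0r.
Qed.

End unitization_maps.

(** * Passing between closed ideals of A and of its unitization *)

Section trace.
Context (R : realType) (A : banachAlgType R[i]).
Local Notation C := R[i].
Local Notation A1 := (unitization A).

Program Definition trace (J : closed_ideal A1) : closed_ideal A :=
  @ClosedIdeal _ _ (@embed R A @^-1` ideal_set J) _ _ _ _ _ _.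
Next Obligation.
move=> J; apply: closed_comp => [a _|]; [exact: embed_continuous | exact: ideal_closed].
Qed.
Next Obligation. by move=> J; exact: ideal0. Qed.
Next Obligation. by move=> J a b Ja Jb; rewrite /= linearD; exact: idealD. Qed.
Next Obligation. by move=> J k a Ja; rewrite /= linearZ; exact: idealZ. Qed.
Next Obligation. by move=> J a b Jb; rewrite /= embedM; exact: ideal_mull. Qed.
Next Obligation. by move=> J a b Jb; rewrite /= embedM; exact: ideal_mulr. Qed.

Program Definition embed_ideal (I : closed_ideal A) : closed_ideal A1 :=
  @ClosedIdeal _ _ [set x | scal_part x = 0 /\ ideal_set I (alg_part x)]
    _ _ _ _ _ _.
Next Obligation.
move=> I; apply: closedI.
  apply: (@closed_comp _ _ (@scal_part R A : A1 -> C^o) [set 0]) => [x _|].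
    exact: scal_part_continuous.
  by apply: accessible_closed_set1; exact: hausdorff_accessible (@norm_hausdorff _ _).
apply: (@closed_comp _ _ (@alg_part R A)) => [x _|].
  exact: alg_part_continuous.
exact: ideal_closed.
Qed.
Next Obligation. by move=> I; split=> //; exact: ideal0. Qed.
Next Obligation.
by move=> I x y [x0 Ix] [y0 Iy]; split; [rewrite /= x0 y0 addr0 | exact: idealD].
Qed.
Next Obligation.
by move=> I k x [x0 Ix]; split; [rewrite /= x0 mulr0 | exact: idealZ].
Qed.
Next Obligation.
move=> I a x [x0 Ix]; split; first by rewrite /= x0 mulr0.
rewrite /= x0 scale0r addr0.
by apply: idealD; [exact: ideal_mull | exact: idealZ].
Qed.
Next Obligation.
move=> I a x [x0 Ix]; split; first by rewrite /= x0 mul0r.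
rewrite /= x0 scale0r addr0.
by apply: idealD; [exact: ideal_mulr | exact: idealZ].
Qed.

Lemma closed_ideal_ext (I I' : closed_ideal A) :
  ideal_set I = ideal_set I' -> I = I'.
Proof.
case: I I' => [S ? ? ? ? ? ?] [S' ? ? ? ? ? ?] /= SS; subst S'.
by congr ClosedIdeal; exact: Prop_irrelevance.
Qed.

(** Every closed ideal of [A] is thus a trace, so the maps built below for traces serve both
    directions of the theorem. *)
Lemma embed_idealK : cancel embed_ideal trace.
Proof.
move=> I; apply: closed_ideal_ext; apply/seteqP.
by split=> a /= => [[]|].
Qed.

End trace.

(** * The inclusion of the trace and a retraction onto it *)

Section trace_maps.
Context (R : realType) (A : banachAlgType R[i]).
Local Notation C := R[i].
Local Notation A1 := (unitization A).
Context (J : closed_ideal A1).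
Local Notation I := (trace J).

Lemma ideal_valE (K : numFieldType) (B : banachAlgType K) (H : closed_ideal B)
  (x : ideal_type H) : ideal_set H (ideal_val x).
Proof. by have := ideal_valP x; rewrite ideal_predE inE. Qed.

Fact trace_incl_subproof (x : ideal_type I) : embed (ideal_val x) \in ideal_pred J.
Proof. by rewrite ideal_predE inE; exact: (ideal_valE x). Qed.

Definition trace_incl (x : ideal_type I) : ideal_type J :=
  IdealElt (trace_incl_subproof x).

Fact trace_incl_linear : linear trace_incl.
Proof. by move=> k x y; apply: val_inj; rewrite /= linearP. Qed.

HB.instance Definition _ :=
  GRing.isLinear.Build C (ideal_type I) (ideal_type J) *:%R trace_incl
    trace_incl_linear.

Lemma trace_incl_continuous : continuous trace_incl.
Proof.
apply: (continuous_of_bound ler01) => x.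
by rewrite mul1r !ideal_normE embed_norm.
Qed.

Lemma trace_incl_lact (a : A) (x : ideal_type I) :
  trace_incl (lact a x) = lact (embed a) (trace_incl x).
Proof. by apply: val_inj; rewrite /= embedM. Qed.

Lemma trace_incl_ract (x : ideal_type I) (a : A) :
  trace_incl (ract x a) = ract (trace_incl x) (embed a).
Proof. by apply: val_inj; rewrite /= embedM. Qed.

(** Used for products of elements of [J] with elements of [A]: their scalar part is 0, which places
    them in the trace. *)
Lemma trace_incl_surj (j : ideal_type J) :
  scal_part (ideal_val j) = 0 -> exists k, j = trace_incl k.
Proof.
move=> j0; have jE : embed (alg_part (ideal_val j)) = ideal_val j.
  by rewrite [RHS]unitization_split j0 scale0r addr0.
have jI : alg_part (ideal_val j) \in ideal_pred I.
  by rewrite ideal_predE inE /= jE; exact: ideal_valE.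
by exists (IdealElt jI); exact: val_inj.
Qed.

Context (e : A).
Hypothesis eJ : forall j : A1, ideal_set J j ->
  ideal_set J (embed (alg_part j + scal_part j *: e)).

Fact trace_retr_subproof (j : ideal_type J) :
  alg_part (ideal_val j) + scal_part (ideal_val j) *: e \in ideal_pred I.
Proof. by rewrite ideal_predE inE; apply: eJ; exact: ideal_valE. Qed.

Definition trace_retr (j : ideal_type J) : ideal_type I :=
  IdealElt (trace_retr_subproof j).

Fact trace_retr_linear : linear trace_retr.
Proof.
move=> k x y; apply: val_inj; rewrite /= scalerDl scalerDr -scalerA.
by rewrite addrACA.
Qed.

HB.instance Definition _ :=
  GRing.isLinear.Build C (ideal_type J) (ideal_type I) *:%R trace_retr
    trace_retr_linear.

Lemma trace_retr_continuous : continuous trace_retr.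
Proof.
apply: (@continuous_of_bound _ _ _ _ (1 + `|e|)); first by rewrite addr_ge0.
move=> x; rewrite !ideal_normE (le_trans (ler_normD _ _)) // mulrDl mul1r.
rewrite lerD ?alg_part_norm // normrZ mulrC ler_wpM2l // scal_part_norm //.
Qed.

Lemma trace_inclK : cancel trace_incl trace_retr.
Proof. by move=> x; apply: val_inj; rewrite /= scale0r addr0. Qed.

End trace_maps.

(** If [u] in [J] has nonzero scalar part, dividing by that scalar gives an element [1 - e] of [J],
    and [x + k e] is [(x + k) - k (1 - e)]. Otherwise all scalar parts vanish on [J] and [e = 0]
    will do. *)
Lemma trace_retraction_exists (R : realType) (A : banachAlgType R[i])
    (J : closed_ideal (unitization A)) :
  exists e : A, forall j, ideal_set J j ->
    ideal_set J (embed (alg_part j + scal_part j *: e)).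
Proof.
have [[u [Ju u0]]|J0] :=
    pselect (exists u, ideal_set J u /\ scal_part u != 0); last first.
  exists 0 => j Jj; rewrite scaler0 addr0.
  have [j0|j0] := eqVneq (scal_part j) 0; last by case: J0; exists j.
  by move: Jj j0; case: j => a k Jj /= j0; rewrite j0 in Jj.
exists (- (scal_part u)^-1 *: alg_part u) => j Jj.
suff -> : embed (alg_part j + scal_part j *: (- (scal_part u)^-1 *: alg_part u))
    = j + (- (scal_part j / scal_part u)) *: u.
  by apply: idealD => //; exact: idealZ.
congr Unitization; first by rewrite /= scalerA mulrN.
by rewrite /= mulNr divfK // subrr.
Qed.

(** * Functionals that vanish on products *)

Section annihilation.
Context (R : realType) (A : banachAlgType R[i]).
Local Notation C := R[i].

Definition full_ideal : closed_ideal A :=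
  @ClosedIdeal _ _ setT closedT I (fun _ _ _ _ => I) (fun _ _ _ => I)
    (fun _ _ _ => I) (fun _ _ _ => I).

Lemma ideal_val_continuous (H : closed_ideal A) :
  continuous (@ideal_val _ _ H).
Proof.
have cT : continuous (\val : {linear ideal_type H -> A}); last exact: cT.
by apply: (continuous_of_bound ler01) => x; rewrite mul1r ideal_normE.
Qed.

(** The space [X] is kept apart from [A] because A^* occurs below as the dual of
    [ideal_type full_ideal], with [g] the copy of [d] there. *)
Definition rank_one (X : normedModType C) (d : dual A) (g : dual X) (a : A) :
  dual X := (d a : C) *: g.

Fact rank_one_linear X d g : linear (@rank_one X d g).
Proof. by move=> k a b; rewrite /rank_one linearP scalerDl -scalerA. Qed.

HB.instance Definition _ X d g :=
  GRing.isLinear.Build C A (dual X) *:%R (@rank_one X d g)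
    (@rank_one_linear X d g).

Lemma rank_one_continuous X d g : continuous (@rank_one X d g).
Proof.
apply: (@continuous_of_bound _ _ _ _ (`|d| * `|g|)); first by rewrite mulr_ge0.
by move=> a; rewrite normrZ mulrAC ler_wpM2r // dual_le.
Qed.

(* The rank-one map a |-> d(a) d is a derivation into A^*; if it is inner then
   d(a)^2 = <d(a) d, a> = <x, aa - aa> = 0. *)
Lemma ideally_amenable_square (d : dual A) : ideally_amenable A ->
  (forall a b, d (bmul a b) = 0) -> forall a, d a = 0.
Proof.
move=> amA dM a.
pose val : {linear ideal_type full_ideal -> A} := \val.
pose g := dual_pullback (@ideal_val_continuous full_ideal : continuous val) d.
have [|x Dx] := amA full_ideal (rank_one d g).
  split=> [|b c]; first exact: rank_one_continuous.
  rewrite /= /rank_one dM scale0r; apply: dual_ext => y.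
  (* Each Leibniz term contains a value of [d] at a product. *)
  change (0 = (d c : C) * d (bmul (ideal_val y) b)
            + (d b : C) * d (bmul c (ideal_val y))).
  by rewrite !dM !mulr0 addr0.
have a_in : a \in ideal_pred full_ideal by rewrite ideal_predE inE.
have := congr1 (fun f : dual _ => f (IdealElt a_in)) (Dx a).
change ((d a : C) * d a =
  x (ract (IdealElt a_in) a) - x (lact a (IdealElt a_in)) -> d a = 0).
have -> : ract (IdealElt a_in) a = lact a (IdealElt a_in) by exact: val_inj.
by rewrite subrr => /eqP; rewrite mulf_eq0 orbb => /eqP.
Qed.

End annihilation.

(** * From A to its unitization *)

Lemma ideally_amenable_unitization (R : realType) (A : banachAlgType R[i]) :
  ideally_amenable A -> ideally_amenable (unitization A).
Proof.
move=> amA J D dD.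
have [e eJ] := trace_retraction_exists J.
have [phi Dphi] := amA (trace J) _ (derivation_pullback (@embed_continuous R A)
  (@trace_incl_continuous _ _ J) (@embedM R A) (@trace_incl_lact _ _ J)
  (@trace_incl_ract _ _ J) dD).
pose psi := dual_pullback (@trace_retr_continuous _ _ J _ eJ) phi.
pose E : {linear unitization A -> dual (ideal_type J)} := D \- ad psi.
have dE : derivation E := derivationB dD (derivation_ad psi).
have E_trace a (k : ideal_type (trace J)) : E (embed a) (trace_incl k) = 0.
  have /= Da := congr1 (fun f : dual _ => f k) (Dphi a).
  (* The retraction fixes the trace, so [psi] extends [phi]. *)
  have psiE m : psi (trace_incl m) = phi m.
    by rewrite -[in RHS](trace_inclK eJ m).
  change (D (embed a) (trace_incl k)
    - (psi (ract (trace_incl k) (embed a)) - psi (lact (embed a) (trace_incl k)))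
    = 0).
  rewrite -trace_incl_lact -trace_incl_ract !psiE.
  by apply/eqP; rewrite subr_eq0; apply/eqP; exact: Da.
have E_embed a : E (embed a) = 0.
  apply: dual_ext => j.
  have dP : (fun b => E (embed b) j : R[i]^o) \in dual_pred A.
    apply/dual_predP; split=> [c b b'|b]; first by rewrite !linearP.
    have cE : {for b, continuous (fun b => E (embed b))}.
      by apply: continuous_comp; [exact: embed_continuous | exact: dE.1].
    exact: (@continuous_comp _ _ _ _ (fun f : dual (ideal_type J) => f j)
      _ cE (@dual_eval_continuous _ _ j _)).
  apply: (@ideally_amenable_square _ _ (Dual dP) amA) => b c.
  change (E (embed (bmul b c)) j = 0).
  rewrite embedM dE.2.
  (* Both Leibniz terms evaluate at a product of [j] with an element of [A], hence at a point of the
     trace, where [E_trace] applies. *)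
  have [k kE] := trace_incl_surj
    (mulr0 _ : scal_part (ideal_val (ract j (embed b))) = 0).
  have [l lE] := trace_incl_surj
    (mul0r _ : scal_part (ideal_val (lact (embed c) j)) = 0).
  change (E (embed c) (ract j (embed b)) + E (embed b) (lact (embed c) j) = 0).
  by rewrite kE lE !E_trace addr0.
have E1 : E (Unitization 0 1) = 0.
  apply: derivation_unit dE _ _ _ => [|f|f].
  - exact: unitization_mul1.
  (* The dual actions exchange sides: acting on the left evaluates at [j] times the unit. *)
  - apply: dual_ext => j; congr (f _); apply: val_inj; exact: unitization_mulr1.
  - apply: dual_ext => j; congr (f _); apply: val_inj; exact: unitization_mul1.
exists psi => x.
have : E x = 0 by rewrite (unitization_split x) linearD linearZ_LR E_embed E1 scaler0 add0r.
by move=> /eqP; rewrite subr_eq0 => /eqP.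
Qed.

(** * From the unitization to A *)

Lemma ideally_amenable_of_unitization (R : realType) (A : banachAlgType R[i]) :
  ideally_amenable (unitization A) -> ideally_amenable A.
Proof.
move=> amA1 I; rewrite -(embed_idealK I); set J := embed_ideal I.
move=> D [cD DM].
have J0 (j : ideal_type J) : scal_part (ideal_val j) = 0.
  by have [] := ideal_valE j.
(* Scalar parts vanish on [J], so [e = 0] gives a retraction, here the inverse of the inclusion. *)
have rJ (j : unitization A) : ideal_set J j ->
    ideal_set J (embed (alg_part j + scal_part j *: 0)).
  by move=> [j0 Ij]; rewrite scaler0 addr0.
(* Composing with [alg_part] extends [D] by 0 at the unit. *)
pose D1 : {linear unitization A -> dual (ideal_type J)} :=
  dual_pullback (@trace_retr_continuous _ _ J _ rJ) \o D \o @alg_part R A.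
have [|psi D1psi] := amA1 J D1.
  split=> [x|x y].
    apply: continuous_comp; first exact: alg_part_continuous.
    by apply: continuous_comp; [exact: cD | exact: dual_pullback_continuous].
  apply: dual_ext => j.
  rewrite /D1 /= !linearD !linearZ /= DM.
  set r := trace_retr rJ.
  (* The scalar terms of the two actions match those that the product [x y] contributes to
     [alg_part]. *)
  have rx : r (ract j x) = ract (r j) (alg_part x) + scal_part x *: r j.
    by apply: val_inj; rewrite /= !scaler0 !addr0 J0 scale0r addr0.
  have ry : r (lact y j) = lact (alg_part y) (r j) + scal_part y *: r j.
    by apply: val_inj; rewrite /= !scaler0 !addr0 J0 scale0r addr0.
  change (D (alg_part y) (ract (r j) (alg_part x))
      + D (alg_part x) (lact (alg_part y) (r j))
      + scal_part x *: D (alg_part y) (r j) + scal_part y *: D (alg_part x) (r j)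
    = D (alg_part y) (r (ract j x)) + D (alg_part x) (r (lact y j))).
  rewrite rx ry !linearD !linearZ_LR.
  by rewrite [LHS](ACl (1 * 3 * (2 * 4))).
(* The restriction of [psi] to the trace implements [D], as seen by evaluating [D1] at [embed a] on
   included elements. *)
exists (dual_pullback (@trace_incl_continuous _ _ J) psi) => a.
apply: dual_ext => k.
have := congr1 (fun f : dual _ => f (trace_incl k)) (D1psi (embed a)).
rewrite /D1 /= trace_inclK => ->.
change (psi (ract (trace_incl k) (embed a)) - psi (lact (embed a) (trace_incl k))
 = psi (trace_incl (ract k a)) - psi (trace_incl (lact a k))).
by rewrite trace_incl_lact trace_incl_ract.
Qed.

Theorem proposition1p14 (R : realType) (A : banachAlgType R[i]) :
  ideally_amenable A <-> ideally_amenable (unitization A).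
Proof.
split; first exact: ideally_amenable_unitization.
exact: ideally_amenable_of_unitization.
Qed.
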